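(* Let $f \in \mathbb{R}[x_1,\dots,x_m]$ be a polynomial of total degree $n\leq m$ that is multiaffine in $x_1,\dots,x_n$ and whose coefficient of $x_1\cdots x_n$ equals one. There exist $n\times n$ (complex) Hermitian matrices $A_{n+1},\dots,A_m,A_0$ such that $$f=\det\Big(\mathrm{diag}(x_1,\dots,x_n)+\sum_{j=n+1}^m x_jA_j+A_0\Big)$$ if and only if for all $i,j\in\{1,\dots,n\}$ the polynomial $\Delta_{ij}(f)$ factors as $g_{ij}\,\overline{g_{ij}}$ for some $g_{ij}\in\mathbb{C}[x_1,\dots,x_m]$.
   Context: A polynomial is multiaffine in $x_1,\dots,x_n$ if it has degree at most $1$ in each of these variables. The Rayleigh difference of $f$ with respect to $i,j$ is $\Delta_{ij}(f)=\frac{\partial f}{\partial x_i}\frac{\partial f}{\partial x_j}-f\,\frac{\partial^2 f}{\partial x_i\partial x_j}$. For $g\in\mathbb{C}[x_1,\dots,x_m]$, $\overline{g}$ is the polynomial obtained by complex-conjugating the coefficients of $g$. *)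

(* Defs.v *)
From mathcomp Require Import all_boot all_order all_algebra.
From mathcomp Require Import reals complex mpoly.

Set Implicit Arguments.
Unset Strict Implicit.
Unset Printing Implicit Defensive.

Import GRing.Theory Num.Theory.
Local Open Scope ring_scope.

(* The degree of p in the single variable 'X_i (0 when p = 0). *)
Definition mdegvar (m : nat) (R : nzRingType) (i : 'I_m)
    (p : {mpoly R[m]}) : nat :=
  (\max_(u <- msupp p) u i)%N.

Definition multiaffine_in (m : nat) (R : nzRingType) (S : {set 'I_m})
    (p : {mpoly R[m]}) : Prop :=
  forall i : 'I_m, i \in S -> (mdegvar i p <= 1)%N.

Definition rayleigh_diff (m : nat) (R : comNzRingType) (i j : 'I_m)
    (f : {mpoly R[m]}) : {mpoly R[m]} :=
  f^`M(i) * f^`M(j) - f * f^`M(i)^`M(j).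

Definition mpoly_conj (m : nat) (R : rcfType)
    (g : {mpoly R[i][m]}) : {mpoly R[i][m]} :=
  map_mpoly Num.conj g.

Definition mpoly_complex (m : nat) (R : rcfType)
    (f : {mpoly R[m]}) : {mpoly R[i][m]} :=
  map_mpoly (real_complex R) f.

Definition mpolyC_mx (m n : nat) (R : nzRingType) (A : 'M[R]_n) :
    'M[{mpoly R[m]}]_n :=
  map_mx (@mpolyC m R) A.

(* Main.v *)
(* Write d_i for the derivative in x_i, bar for conjugation of coefficients and
   D_ij for the Rayleigh differences. If N = diag(x) + A, then G = adj N and
   f = det N satisfy G_ii = d_i f and

     (E)   G_ij G_jl = d_j f G_il - f d_j G_il   for all i, j, l,

   and the case l = i exhibits D_ij as G_ij bar(G_ij).

   Conversely, a Hermitian solution G of (E) with G_ii = d_i f is built one index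
   at a time. When G is known on the indices below k, the polynomials
   R_ij = d_k f G_ij - f d_k G_ij form a Hermitian matrix of rank at most one
   whose diagonal entries D_jk are norms. As the polynomial ring is factorial,
   R = t t^* for some polynomial vector t, which is the new column of G.

   Heuristically, (E) says that Y = G / f satisfies d_j Y = - Y E_jj Y, so that
   Y^-1 - diag(x) should be constant in x_1, ..., x_n. The entries of A are
   therefore read off the leading coefficients of G, and a comparison of leading
   monomials turns the equation f d_j M = d_j f M - M E_jj G satisfied by the
   defect M = (diag(x) + A) G - f into M = 0, and then yields
   f = det(diag(x) + A). *)

Require Import Defs.
From mathcomp Require Import all_boot all_order all_algebra.
From mathcomp Require Import fingroup perm reals complex mpoly boolp zify ring.

Set Implicit Arguments.
Unset Strict Implicit.
Unset Printing Implicit Defensive.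

Import Order.TTheory GRing.Theory Num.Theory.
Local Open Scope ring_scope.

(** * Factoriality of polynomial rings *)

Definition divides (R : comNzRingType) (a b : R) : Prop := exists c, b = c * a.

Definition prime_elt (R : idomainType) (p : R) : Prop :=
  [/\ p != 0, p \isn't a GRing.unit
    & forall a b : R, divides p (a * b) -> divides p a \/ divides p b].

(* Factoriality, with an additive length function in place of the ascending
   chain condition on principal ideals. *)
Definition factorial_domain (R : idomainType) : Prop :=
  exists len : R -> nat,
    [/\ forall a b : R, a != 0 -> b != 0 -> len (a * b) = (len a + len b)%N,
        forall a : R, a != 0 -> len a = 0%N -> a \is a GRing.unit
      & forall a : R, a != 0 -> a \isn't a GRing.unit ->
          exists p : R, prime_elt p /\ divides p a].

Section Divides.
Context {R : comNzRingType}.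
Implicit Types a b c d : R.

Lemma divides_refl a : divides a a.
Proof. by exists 1; rewrite mul1r. Qed.

Lemma divides0 a : divides a 0.
Proof. by exists 0; rewrite mul0r. Qed.

Lemma divides_mull a b c : divides a b -> divides a (c * b).
Proof. by move=> [d ->]; exists (c * d); rewrite mulrA. Qed.

Lemma divides_mulr a b c : divides a b -> divides a (b * c).
Proof. by rewrite mulrC; exact: divides_mull. Qed.

Lemma dividesD a b c : divides a b -> divides a c -> divides a (b + c).
Proof. by move=> [d ->] [e ->]; exists (d + e); rewrite mulrDl. Qed.

Lemma dividesB a b c : divides a b -> divides a c -> divides a (b - c).
Proof. by move=> [d ->] [e ->]; exists (d - e); rewrite mulrBl. Qed.

Lemma divides_trans a b c : divides a b -> divides b c -> divides a c.
Proof. by move=> ab [d ->]; exact: divides_mull. Qed.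

End Divides.

Lemma divides_polyC (R : comNzRingType) c (p : {poly R}) :
  divides c%:P p <-> forall i, divides c p`_i.
Proof.
split=> [[q ->] i|]; first by exists q`_i; rewrite coefMC.
elim/poly_ind: p => [|p a IHp] H; first exact: divides0.
apply: dividesD.
  apply/divides_mulr/IHp => i; have := H i.+1.
  by rewrite coefD coefMX coefC /= addr0.
have := H 0%N; rewrite coefD coefMX coefC /= add0r => -[b ->].
by exists b%:P; rewrite polyCM.
Qed.

Lemma divides_polyC_mulX (R : comNzRingType) c (p : {poly R}) :
  divides c%:P (p * 'X) -> divides c%:P p.
Proof.
by move/divides_polyC=> H; apply/divides_polyC => i;
  have := H i.+1; rewrite coefMX.
Qed.

Lemma factorial_field (F : fieldType) : factorial_domain F.
Proof.
exists (fun=> 0%N); split=> // a a0; rewrite unitfE ?a0 //.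
Qed.

(** * Gauss's lemma: factoriality of univariate polynomial rings *)

Section FactorialPoly.
Variable R : idomainType.
Implicit Types (c d a b : R) (p q u v : {poly R}).

Lemma prime_polyC c : prime_elt c -> prime_elt c%:P.
Proof.
move=> [c0 cu cP]; split; first by rewrite polyC_eq0.
  by rewrite poly_unitE coefC eqxx negb_and cu orbT.
move=> p; elim/poly_ind: p => [|p a IHp] q; first by left; exact: divides0.
have [ca|Nca] := pselect (divides c a) => H.
  have ca' : divides c%:P (a%:P) by case: ca => d ->; exists d%:P; rewrite polyCM.
  have : divides c%:P (p * q).
    apply: divides_polyC_mulX.
    have -> : p * q * 'X = (p * 'X + a%:P) * q - a%:P * q
      by rewrite mulrDl addrK mulrAC.
    exact/(dividesB H)/divides_mulr.
  by case/IHp=> [cp|]; [left; apply: dividesD => //; apply: divides_mulr|right].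
elim/poly_ind: q H => [|q b IHq] H; first by right; exact: divides0.
have cb : divides c b.
  have/divides_polyC/(_ 0%N) := H.
  rewrite coef0M !coefD !coefMX !coefC !eqxx !add0r.
  by case/cP.
have cb' : divides c%:P b%:P by case: cb => d ->; exists d%:P; rewrite polyCM.
have : divides c%:P ((p * 'X + a%:P) * q).
  apply: divides_polyC_mulX; move: H; set r := _ + _ => H.
  have -> : r * q * 'X = r * (q * 'X + b%:P) - r * b%:P
    by rewrite mulrDr addrK mulrA.
  exact/(dividesB H)/divides_mull.
by case/IHq=> [|cq]; [left|right; apply: dividesD => //; apply: divides_mulr].
Qed.

Definition primitive_poly p : Prop :=
  forall c, prime_elt c -> ~ divides c%:P p.

Hypothesis factR : factorial_domain R.

(** Prime constants are divided out one at a time, and each shortens the leading coefficient. *)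
Lemma content_split p : p != 0 ->
  exists c q, [/\ c != 0, p = c%:P * q & primitive_poly q].
Proof.
have [len [lenM len0 _]] := factR.
have [k] := ubnP (len (lead_coef p)); elim: k p => // k IHk p lek p0.
have [[c [cp cdvd]]|nex] :=
    pselect (exists c, prime_elt c /\ divides c%:P p); last first.
  by exists 1, p; split; rewrite ?oner_eq0 ?mul1r // => c cp H; apply: nex; exists c.
case: cdvd => q qE; have [c0 cu _] := cp.
have q0 : q != 0 by apply: contraNneq p0 => q0; rewrite qE q0 mul0r.
have lc : (0 < len c)%N.
  by rewrite lt0n; apply: contraNneq cu => /(len0 _ c0).
have [] := IHk q _ q0.
  move: lek; rewrite qE lead_coefM lead_coefC lenM ?lead_coef_eq0 //.
  by lia.
move=> d [r [d0 rE rP]]; exists (c * d), r; split=> //; first by rewrite mulf_neq0.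
by rewrite qE rE polyCM; rewrite mulrC mulrA.
Qed.

(** A prime factor of [c] stays prime as a constant polynomial and cannot divide the primitive [q].
    It therefore divides [v] and cancels, until [c] is a unit. *)
Lemma primitive_cancel q c u v : primitive_poly q -> c != 0 ->
  c%:P * u = v * q -> divides q u.
Proof.
have [len [lenM len0 primeR]] := factR => qP.
have [k] := ubnP (len c); elim: k c v => // k IHk c v lek c0 E.
have [cu|cu] := boolP (c \is a GRing.unit).
  exists ((c^-1)%:P * v); rewrite -mulrA -E mulrA -polyCM mulVr //.
  by rewrite mul1r.
have [d [dP [e cE]]] := primeR c c0 cu; have [d0 du _] := dP.
have [_ _ dP'] := prime_polyC dP.
have e0 : e != 0 by apply: contraNneq c0 => e0; rewrite cE e0 mul0r.
have ld : (0 < len d)%N.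
  by rewrite lt0n; apply: contraNneq du => /(len0 _ d0).
have : divides d%:P (v * q).
  by rewrite -E cE polyCM; apply/divides_mulr/divides_mull/divides_refl.
case/dP' => [[w wE]|/(qP d dP)//].
apply: (IHk e w) => //; first by move: lek; rewrite cE lenM //; lia.
apply: (@mulfI _ d%:P); first by rewrite polyC_eq0.
by rewrite mulrA -polyCM mulrC (mulrC d) -cE mulrC E wE mulrCA mulrA.
Qed.

(* A nonconstant divisor of least degree, made primitive, is prime: it is
   irreducible over the field of fractions, and divisibility over that field
   is honest divisibility by [primitive_cancel]. *)
Lemma prime_divisor_nonconst p : (1 < size p)%N ->
  exists q, prime_elt q /\ divides q p.
Proof.
move=> sp; have p0 : p != 0 by rewrite -size_poly_gt0; exact: ltnW.
pose P k := `[< exists q, [/\ (1 < size q)%N, size q = k & divides q p] >].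
have exP : exists k, P k.
  by exists (size p); apply/asboolP; exists p; split=> //; exact: divides_refl.
case: (ex_minnP exP) => k /asboolP[q0 [sq0 skq0 q0p]] kmin {exP}.
have q00 : q0 != 0 by rewrite -size_poly_gt0; exact: ltnW.
have [c [q [c0 q0E qP]]] := content_split q00.
have sq : size q = k by rewrite -skq0 q0E mul_polyC size_scale.
have dvq : divides q p.
  by apply: divides_trans q0p; rewrite q0E; exists c%:P.
have minq u : divides u q -> (1 < size u)%N -> (size q <= size u)%N.
  move=> uq su; rewrite sq; apply: kmin; apply/asboolP; exists u; split=> //.
  exact: divides_trans uq dvq.
have qn0 : q != 0 by rewrite -size_poly_gt0 sq -skq0; exact: ltnW.
have sq1 : (1 < size q)%N by rewrite sq -skq0.
have irr u : size u != 1%N -> Pdiv.Idomain.dvdp u q -> (u %= q).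
  move=> su /Pdiv.Idomain.dvdpP[[a v] /= a0 E].
  have u0 : u != 0.
    apply: contraNneq qn0 => u0; rewrite u0 mulr0 in E.
    by move/eqP: E; rewrite -mul_polyC mulf_eq0 polyC_eq0 (negPf a0).
  have [d [w [d0 uE wP]]] := content_split u0.
  have sw : size u = size w by rewrite uE mul_polyC size_scale.
  have wq : divides w q.
    apply: (primitive_cancel wP a0); rewrite mul_polyC E uE mulrA; reflexivity.
  have le1 : (size q <= size w)%N.
    apply: minq => //; rewrite -sw.
    by move: u0 su; rewrite -size_poly_gt0; case: (size u) => [|[]].
  have uq : Pdiv.Idomain.dvdp u q.
    by apply/Pdiv.Idomain.dvdpP; exists (a, v).
  rewrite -Pdiv.Idomain.dvdp_size_eqp // eqn_leq Pdiv.Idomain.dvdp_leq //=.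
  by rewrite sw.
exists q; split=> //; split=> //.
  by apply: contraTN sq1; rewrite poly_unitE => /andP[/eqP-> _].
move=> a b [w E].
have hab : Pdiv.Idomain.dvdp q (a * b) by rewrite E Pdiv.Idomain.dvdp_mull.
have conv u : Pdiv.Idomain.dvdp q u -> divides q u.
  by case/Pdiv.Idomain.dvdpP=> -[d v] /= d0; rewrite -mul_polyC; exact: primitive_cancel.
have [g1|g1] := eqVneq (size (Pdiv.Idomain.gcdp q a)) 1%N.
  right; apply: conv; rewrite -(@Pdiv.Idomain.Gauss_dvdpr _ b a) //.
  by rewrite Pdiv.Idomain.coprimep_def g1.
left; apply: conv.
have := irr _ g1 (Pdiv.Idomain.dvdp_gcdl _ _).
move/Pdiv.Idomain.eqp_dvdl <-; exact: Pdiv.Idomain.dvdp_gcdr.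
Qed.

Lemma factorial_poly : factorial_domain {poly R}.
Proof.
have [len [lenM len0 primeR]] := factR.
exists (fun p => len (lead_coef p) + (size p).-1)%N; split.
- move=> p q p0 q0; rewrite lead_coefM lenM ?lead_coef_eq0 // size_mul //.
  by move: p0 q0; rewrite -!size_poly_gt0; lia.
- move=> p p0 /eqP; rewrite addn_eq0 => /andP[/eqP lp /eqP sp].
  have /size_poly1P[c c0 pE] : size p == 1%N.
    by move: p0; rewrite -size_poly_gt0; move: sp; case: (size p) => [|[]].
  rewrite pE poly_unitE size_polyC c0 /= coefC /=; apply: len0 => //.
  by move: lp; rewrite pE lead_coefC.
- move=> p p0 pu; have [sp|sp] := ltnP 1 (size p).
    exact: prime_divisor_nonconst.
  have pE := size1_polyC sp; rewrite pE in p0 pu *.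
  move: p0 pu; rewrite polyC_eq0 => p0 pu.
  have [|q [qP [c E]]] := primeR _ p0.
    by apply: contra pu; rewrite poly_unitE size_polyC p0 coefC.
  exists q%:P; split; first exact: prime_polyC.
  by exists c%:P; rewrite -polyCM -E.
Qed.

End FactorialPoly.

Lemma factorial_iso (A B : idomainType) (phi : {rmorphism A -> B}) :
  bijective phi -> factorial_domain B -> factorial_domain A.
Proof.
case=> psi phiK psiK [len [lenM len0 primeB]].
have inj : injective phi := can_inj phiK.
have phi0 a : (phi a == 0) = (a == 0) by rewrite -(inj_eq inj) rmorph0.
have psiM x y : psi (x * y) = psi x * psi y.
  by apply: inj; rewrite rmorphM !psiK.
have psi1 : psi 1 = 1 by apply: inj; rewrite rmorph1 psiK.
have unitE a : (a \is a GRing.unit) = (phi a \is a GRing.unit).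
  apply/idP/idP => [|H]; first exact: rmorph_unit.
  apply/unitrP; exists (psi (phi a)^-1).
  by split; apply: inj; rewrite rmorphM psiK rmorph1 ?mulVr ?mulrV.
have dvE a b : divides a b <-> divides (phi a) (phi b).
  split=> [[c ->]|[c E]]; first by exists (phi c); rewrite rmorphM.
  by exists (psi c); apply: inj; rewrite rmorphM psiK.
exists (len \o phi); split=> [a b a0 b0|a a0|a a0 au] /=.
- by rewrite rmorphM lenM ?phi0.
- by rewrite unitE; apply: len0; rewrite phi0.
have [||p [[p0 pu pP] pa]] := primeB (phi a); rewrite ?phi0 -?unitE //.
exists (psi p); split; last by apply/dvE; rewrite psiK.
split; rewrite -?phi0 ?unitE ?psiK // => b c /dvE.
by rewrite psiK rmorphM => /pP[] H; [left|right]; apply/dvE; rewrite psiK.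
Qed.

(** * Polynomials in n + 1 variables as univariate polynomials *)

Section MuniBijective.
Variables (n : nat) (R : idomainType).
Local Notation widen := (widen_ord (leqnSn n)).

Lemma muniX (u : 'X_{1..n.+1}) :
  muni 'X_[R, u] = 'X_[[multinom u (widen i) | i < n]] *: 'X^(u ord_max).
Proof. by rewrite muniE msuppX big_seq1 mcoeffX eqxx scale1r. Qed.

Lemma muni_mwiden (p : {mpoly R[n]}) : muni (mwiden p) = p%:P.
Proof.
rewrite {2}[p]mpolyE {1}[p]mpolyE (raddf_sum (@mwiden n R)).
rewrite (raddf_sum (@muni n R)) raddf_sum; apply: eq_bigr => u _ /=.
rewrite mwidenZ mwidenX muniZ muniX mnmwiden_ordmax expr0.
rewrite -!mul_polyC mulr1 -polyCM mul_mpolyC; congr (_ *: _)%:P.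
by congr 'X_[_]; apply/mnmP => i; rewrite mnmE mnmwiden_widen.
Qed.

Lemma muni_bij : bijective (@muni n R).
Proof.
(* The inverse embeds the coefficients and evaluates at the last variable. *)
pose psi (q : {poly {mpoly R[n]}}) : {mpoly R[n.+1]} :=
  (map_poly (@mwiden n R) q).['X_ord_max].
have psi_mono a k : psi (a *: 'X^k) = mwiden a * 'X_ord_max ^+ k.
  by rewrite /psi map_polyZ /= map_polyXn hornerZ hornerXn.
have psiD : {morph psi : p q / p + q}.
  by move=> p q; rewrite /psi rmorphD hornerD.
have psi0 : psi 0 = 0 by rewrite /psi rmorph0 horner0.
have Xmax : muni ('X_ord_max : {mpoly R[n.+1]}) = 'X.
  rewrite muniX mnm1E eqxx expr1.
  have -> : [multinom U_(ord_max)%MM (widen i) | i < n] = 0%MM.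
    by apply/mnmP => i; rewrite mnmE mnm1E mnm0E -val_eqE /= gtn_eqF.
  by rewrite mpolyX0 scale1r.
exists psi => [p|q].
  rewrite muniE (big_morph psi psiD psi0) {3}[p]mpolyE; apply: eq_bigr => u _.
  rewrite psi_mono mwidenZ mwidenX -scalerAl; congr (_ *: _).
  rewrite mpolyXn -mpolyXD; congr 'X_[_]; apply/mnmP => i.
  rewrite mnmDE mulmnE mnm1E (eq_sym ord_max).
  have [->|] := eqVneq i ord_max.
    by rewrite mnmwiden_ordmax mul1n.
  rewrite mul0n addn0 => ni.
  have lti : (i < n)%N.
    by rewrite ltn_neqAle -ltnS ltn_ord andbT; move: ni; rewrite -val_eqE.
  have -> : i = widen (Ordinal lti) by apply/val_inj.
  by rewrite mnmwiden_widen mnmE.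
elim/poly_ind: q => [|q c IHq]; first by rewrite psi0 muni0.
rewrite psiD muniD; congr (_ + _).
  by rewrite /psi rmorphM /= map_polyX hornerM hornerX muniM Xmax IHq.
by rewrite /psi map_polyC hornerC muni_mwiden.
Qed.

End MuniBijective.

Lemma factorial_mpoly (F : fieldType) n : factorial_domain {mpoly F[n]}.
Proof.
elim: n => [|n IHn]; last exact: (factorial_iso (@muni_bij n F) (factorial_poly IHn)).
apply: (@factorial_iso _ F (@mcoeff 0 F 0%MM)); last exact: factorial_field.
have E (u : 'X_{1..0}) : u = 0%MM by apply/mnmP => -[].
exists (@mpolyC 0 F) => [p|c] /=; last by rewrite mcoeffC eqxx mulr1.
by apply/mpolyP => u; rewrite mcoeffC (E u) eqxx mulr1.
Qed.

(** * Factoring the Rayleigh differences coherently *)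

(* By induction on the length of g: a prime dividing g divides all the v i, or
   its conjugate does, so one of the two can be moved into e. *)
Lemma norm_split_vector (P : idomainType) (cj : {rmorphism P -> P}) (I : Type)
    (v : I -> P) (g : P) :
  involutive cj -> factorial_domain P -> g != 0 ->
  (forall i j, divides (g * cj g) (cj (v i) * v j)) ->
  exists e, e * cj e = g * cj g /\ forall i, divides e (v i).
Proof.
move=> cjK [len [lenM len0 primeP]].
have [k] := ubnP (len g); elim: k g v => // k IHk g v leg g0 H.
have [gu|gu] := boolP (g \is a GRing.unit).
  by exists g; split=> // i; exists (v i * g^-1); rewrite divrK.
have [p [pP [h gE]]] := primeP g g0 gu; have [p0 pu pM] := pP.
have h0 : h != 0 by apply: contraNneq g0 => h0; rewrite gE h0 mul0r.
have cj0 a : a != 0 -> cj a != 0.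
  by apply: contraNneq => a0; rewrite -[a]cjK a0 rmorph0.
have lp : (0 < len p)%N.
  by rewrite lt0n; apply: contraNneq pu => /(len0 _ p0).
have lh : (len h < k)%N by move: leg; rewrite gE lenM //; lia.
have gcE : g * cj g = (h * cj h) * (p * cj p) by rewrite gE rmorphM /=; ring.
have red (w : I -> P) : (forall i j, cj (v i) * v j = (p * cj p) * (cj (w i) * w j)) ->
    forall i j, divides (h * cj h) (cj (w i) * w j).
  move=> E i j; have [c cE] := H i j; exists c.
  have /mulfI : p * cj p != 0 by rewrite mulf_neq0 ?cj0.
  by apply; rewrite -E cE gcE; ring.
have pv i j : divides p (cj (v i) * v j).
  by apply: divides_trans (H i j); exists (h * cj g); rewrite gE; ring.
have [pr|npr] := pselect (forall j, divides p (v j)).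
  have [w wE] := choice pr.
  have [|e [eE ew]] := IHk h w lh h0.
    by apply: red => i j; rewrite !wE rmorphM /=; ring.
  exists (p * e); split; first by rewrite gcE -eE rmorphM /=; ring.
  by move=> i; have [c wc] := ew i; exists c; rewrite wE wc; ring.
have pl i : divides (cj p) (v i).
  have [j npj] : exists j, ~ divides p (v j) by exact/existsNP.
  have [[c cE]|//] := pM _ _ (pv i j).
  by exists (cj c); rewrite -rmorphM -cE cjK.
have [w wE] := choice pl.
have [|e [eE ew]] := IHk h w lh h0.
  by apply: red => i j; rewrite !wE !rmorphM /= cjK; ring.
exists (cj p * e); split; first by rewrite gcE -eE rmorphM /= cjK; ring.
by move=> i; have [c wc] := ew i; exists c; rewrite wE wc; ring.
Qed.

(** * Norms and Rayleigh differences in a domain with commuting derivations *)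

Section Rayleigh.
Variables (P : idomainType) (cj : {rmorphism P -> P}) (n : nat).
Variables (D : 'I_n -> {additive P -> P}) (F : P).
Hypotheses (cjK : involutive cj) (factP : factorial_domain P).
Hypothesis char0 : forall k, k.+1%:R != 0 :> P.
Hypothesis DM : forall i p q, D i (p * q) = D i p * q + p * D i q.
Hypothesis DC : forall i j p, D i (D j p) = D j (D i p).
Hypothesis Dcj : forall i p, D i (cj p) = cj (D i p).
Hypothesis Dnil : forall i p, exists k, iter k (D i) p = 0.
Hypotheses (cjF : cj F = F) (DDF : forall i, D i (D i F) = 0).

Lemma iter_derivD i k p q :
  iter k (D i) (p + q) = iter k (D i) p + iter k (D i) q.
Proof. by elim: k => //= k ->; rewrite raddfD. Qed.

(** In the Leibniz expansion only the term with [a] derivatives on [p] and [b] on [q] survives; its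
    coefficient follows from Pascal's rule. *)
Lemma iter_derivM_top i a b p q :
  iter a.+1 (D i) p = 0 -> iter b.+1 (D i) q = 0 ->
  iter (a + b) (D i) (p * q) = (iter a (D i) p * iter b (D i) q) *+ 'C(a + b, a).
Proof.
have [k] := ubnP (a + b)%N; elim: k a b p q => // k IHk [|a] [|b] p q.
- by rewrite bin0.
- rewrite add0n ltnS => leb pa qb; rewrite iterSr DM [D i p]pa mul0r add0r.
  rewrite iterSr in qb.
  by have -> := IHk 0%N b p (D i q) leb pa qb; rewrite !bin0 [in RHS]iterSr.
- rewrite addn0 ltnS => lea pa qb; rewrite iterSr DM [D i q]qb mulr0 addr0.
  rewrite iterSr in pa.
  have := IHk a 0%N (D i p) q; rewrite addn0 => -> //.
  by rewrite !binn [in RHS]iterSr.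
move=> lek pa qb; rewrite addSn iterSr DM iter_derivD.
have pa' := pa; have qb' := qb; rewrite iterSr in pa'; rewrite iterSr in qb'.
rewrite (IHk a b.+1 (D i p) q) //.
have := IHk a.+1 b p (D i q); rewrite addSn -addnS => -> //.
by rewrite -!iterSr -mulrnDr binS [('C(_, a) + _)%N]addnC.
Qed.

Lemma iter_deriv_le i a b p : (a <= b)%N ->
  iter a (D i) p = 0 -> iter b (D i) p = 0.
Proof.
move=> /subnK <- pa; rewrite iterD pa.
by elim: (b - a)%N => //= k ->; rewrite raddf0.
Qed.

(** A norm has twice the degree of [u] in the i-th variable: for [u] of degree k, the derivative of
    order 2k is a nonzero multiple of the norm of the top derivative of [u]. *)
Lemma norm_deriv_nil i u a b :
  iter b (D i) (u * cj u) = 0 -> (b <= a + a)%N -> iter a (D i) u = 0.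
Proof.
move=> Hb leb.
have exk : exists k, iter k (D i) u == 0.
  by have [k uk] := Dnil i u; exists k; apply/eqP.
case: (ex_minnP exk) => k /eqP uk kmin.
have [leka|ltak] := leqP k a; first exact: iter_deriv_le uk.
case: k ltak uk kmin => // k leak uk kmin.
have ukn : iter k (D i) u != 0 by apply/negP => /kmin; rewrite ltnn.
have cE m : iter m (D i) (cj u) = cj (iter m (D i) u).
  by elim: m => //= m ->; rewrite Dcj.
have := iter_derivM_top uk (etrans (cE k.+1) (etrans (congr1 cj uk) (rmorph0 _))).
rewrite (iter_deriv_le _ Hb) ?cE; last by lia.
have : (0 < 'C(k + k, k))%N by rewrite bin_gt0 leq_addl.
case: 'C(_, _) => // c _ /esym/eqP; rewrite -mulr_natr !mulf_eq0.
rewrite (negPf (char0 c)) (negPf ukn) /= orbF -(rmorph0 cj).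
by rewrite (inj_eq (can_inj cjK)) (negPf ukn).
Qed.

Lemma DDC i j p : D j (D j (D i p)) = D i (D j (D j p)).
Proof. by rewrite (DC j i p) (DC j i). Qed.

Definition rayleigh i j := D i F * D j F - F * D i (D j F).

(* Up to sign, the resultant of F and p with respect to the i-th variable,
   when both have degree at most one in it. *)
Definition affine_res i p := D i F * p - F * D i p.

Lemma rayleighC i j : rayleigh i j = rayleigh j i.
Proof. by rewrite /rayleigh DC; ring. Qed.

Lemma affine_res_rayleigh i j : affine_res i (D j F) = rayleigh i j.
Proof. by []. Qed.

Lemma cj_affine_res i p : cj (affine_res i p) = affine_res i (cj p).
Proof.
have cjDF : cj (D i F) = D i F by rewrite -Dcj cjF.
by rewrite /affine_res rmorphB !rmorphM /= cjF cjDF Dcj.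
Qed.

Lemma D_rayleigh i j : D i (rayleigh i j) = 0.
Proof. by rewrite /rayleigh raddfB /= !DM DDF DDC DDF raddf0; ring. Qed.

Lemma D3_rayleigh i j l : iter 3 (D l) (rayleigh i j) = 0.
Proof.
have D3M p q : D l (D l p) = 0 -> D l (D l q) = 0 -> iter 3 (D l) (p * q) = 0.
  move=> p0 q0 /=; rewrite DM !raddfD /= !DM !raddfD /= !DM p0 q0 !raddf0.
  by rewrite !(mul0r, mulr0, addr0, add0r).
have iterB p q : iter 3 (D l) (p - q) = iter 3 (D l) p - iter 3 (D l) q.
  by rewrite /= !raddfB.
by rewrite /rayleigh iterB !D3M ?subr0 ?DDC ?DDF ?raddf0.
Qed.

Section Norm.
Variables (i j : 'I_n) (u : P).
Hypothesis uE : u * cj u = rayleigh i j.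

Lemma norm_rayleighl : D i u = 0.
Proof. by apply: (@norm_deriv_nil i u 1 1) => //=; rewrite uE D_rayleigh. Qed.

Lemma norm_rayleighr : D j u = 0.
Proof. by apply: (@norm_deriv_nil j u 1 1) => //=; rewrite uE rayleighC D_rayleigh. Qed.

(** The Rayleigh difference has degree at most 2 in each variable, so [u] has degree at most 1. *)
Lemma norm_rayleigh2 l : D l (D l u) = 0.
Proof. by apply: (@norm_deriv_nil l u 2 3) => //; rewrite uE D3_rayleigh. Qed.

End Norm.

Lemma norm_eq0 u : u * cj u = 0 -> u = 0.
Proof.
move/eqP; rewrite mulf_eq0 => /orP[/eqP//|/eqP cu].
by rewrite -[u]cjK cu rmorph0.
Qed.

Lemma mulr2n_inj (p q : P) : p + p = q + q -> p = q.
Proof.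
move/eqP; rewrite -!mulr2n -subr_eq0 -mulrnBl -mulr_natr mulf_eq0.
by rewrite (negPf (char0 1)) orbF subr_eq0 => /eqP.
Qed.

(** As [t] is affine in the j-th variable, the left side depends only on the norm of [t] and its
    first two derivatives. These are computed from [rayleigh i k] in [e1] and [e2]. *)
Lemma affine_res_norm i j k t : t * cj t = rayleigh i k ->
  affine_res j t * cj (affine_res j t) = rayleigh i j * rayleigh j k.
Proof.
move=> tE; have tjj := norm_rayleigh2 tE j.
have ctjj : D j (D j (cj t)) = 0 by rewrite !Dcj tjj rmorph0.
have e1 : D j t * cj t + t * D j (cj t) =
    D i (D j F) * D k F + D i F * D j (D k F) - D j F * D i (D k F)
    - F * D i (D j (D k F)).
  rewrite -DM tE /rayleigh raddfB /= !DM (DC j i F) (DC j i); ring.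
have e2 : D j t * D j (cj t) =
    D i (D j F) * D j (D k F) - D j F * D i (D j (D k F)).
  have z p : D j (D j p) = 0 -> D j (D i (D j p)) = 0.
    by move=> p0; rewrite (DC i j p) DDC p0 raddf0.
  have jkF : D j (D j (D k F)) = 0 by rewrite DDC DDF raddf0.
  apply: mulr2n_inj; have := congr1 (D j) e1.
  rewrite !(raddfD, raddfN) /= !DM tjj ctjj (z F) // (z (D k F)) // jkF DDF.
  rewrite (DC j i F) (DC j i (D k F)) => E.
  transitivity (D j (D j t) * cj t + D j t * D j (cj t)
      + (D j t * D j (cj t) + t * D j (D j (cj t)))).
    by rewrite tjj ctjj; ring.
  by rewrite tjj ctjj E; ring.
rewrite cj_affine_res /affine_res /rayleigh.
transitivity (D j F * D j F * (t * cj t)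
  - F * D j F * (D j t * cj t + t * D j (cj t)) + F * F * (D j t * D j (cj t))).
  by ring.
by rewrite e1 e2 tE /rayleigh; ring.
Qed.

(** For [p] affine in the k-th variable, [affine_res k p] is [D k F] times the value of [p] at the
    root of [F] in that variable. A relation modulo [F] thus becomes an equation; the proof replaces
    evaluation by comparing derivatives. *)
Lemma affine_res_mul k p1 p2 q1 q2 r :
  D k (D k p1) = 0 -> D k (D k p2) = 0 -> D k (D k q1) = 0 ->
  D k (D k q2) = 0 -> D k (D k r) = 0 -> p1 * p2 = q1 * q2 - F * r ->
  affine_res k p1 * affine_res k p2 = affine_res k q1 * affine_res k q2.
Proof.
move=> p10 p20 q10 q20 r0 e0.
have e1 : D k p1 * p2 + p1 * D k p2 =
    D k q1 * q2 + q1 * D k q2 - D k F * r - F * D k r.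
  by rewrite -DM e0 raddfB /= !DM; ring.
have e2 : D k p1 * D k p2 = D k q1 * D k q2 - D k F * D k r.
  apply: mulr2n_inj; have := congr1 (D k) e1.
  rewrite !(raddfD, raddfN) /= !DM p10 p20 q10 q20 r0 DDF => E.
  transitivity (0 * p2 + D k p1 * D k p2 + (D k p1 * D k p2 + p1 * 0)).
    by ring.
  by rewrite E; ring.
rewrite /affine_res.
transitivity (D k F * D k F * (p1 * p2)
  - F * D k F * (D k p1 * p2 + p1 * D k p2) + F * F * (D k p1 * D k p2)).
  by ring.
by rewrite e0 e1 e2; ring.
Qed.

(** The system (E) restricted to indices below [k]. The matrix is indexed by all of ['I_n] so that
    its type does not change during the induction; other entries are unconstrained. *)
Definition adjugate_system k (G : 'I_n -> 'I_n -> P) : Prop :=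
  [/\ forall i : 'I_n, (i < k)%N -> G i i = D i F,
      forall i j : 'I_n, (i < k)%N -> (j < k)%N -> cj (G i j) = G j i
    & forall i j l : 'I_n, (i < k)%N -> (j < k)%N -> (l < k)%N ->
        G i j * G j l = affine_res j (G i l)].

Hypothesis rayleighP : forall i j, exists g, rayleigh i j = g * cj g.

(** * Extending a solution of (E) by one index *)

Section Step.
Variables (k : 'I_n) (G : 'I_n -> 'I_n -> P).
Hypothesis GP : adjugate_system k G.

Let Gii (i : 'I_n) : (i < k)%N -> G i i = D i F. Proof. by have [+ _ _] := GP; apply. Qed.
Let cjG (i j : 'I_n) : (i < k)%N -> (j < k)%N -> cj (G i j) = G j i.
Proof. by have [_ + _] := GP; apply. Qed.
Let GG (i j l : 'I_n) : (i < k)%N -> (j < k)%N -> (l < k)%N ->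
  G i j * G j l = affine_res j (G i l).
Proof. by have [_ _ +] := GP; apply. Qed.

Lemma system_norm (i j : 'I_n) : (i < k)%N -> (j < k)%N ->
  G i j * cj (G i j) = rayleigh i j.
Proof. by move=> ik jk; rewrite cjG // GG // Gii // affine_res_rayleigh rayleighC. Qed.

Lemma system_D2 (i j l : 'I_n) : (i < k)%N -> (j < k)%N -> D l (D l (G i j)) = 0.
Proof. by move=> ik jk; apply: norm_rayleigh2 (system_norm ik jk) l. Qed.

(** By (E), the minor G_ij G_jl - G_jj G_il is a multiple of [F], so [affine_res_mul] applies. *)
Lemma system_rank1 (i j l : 'I_n) : (i < k)%N -> (j < k)%N -> (l < k)%N ->
  affine_res k (G i j) * affine_res k (G j l) = affine_res k (G j j) * affine_res k (G i l).
Proof.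
move=> ik jk lk; apply: (@affine_res_mul _ _ _ _ _ (D j (G i l))); rewrite ?system_D2 //.
  by rewrite DDC system_D2 // raddf0.
by rewrite GG // Gii.
Qed.

Lemma system_new_column : exists t : 'I_n -> P,
  forall i j : 'I_n, (i < k)%N -> (j < k)%N -> affine_res k (G i j) = t i * cj (t j).
Proof.
have [[p [pk Rp0]]|nex] :=
    pselect (exists p : 'I_n, (p < k)%N /\ affine_res k (G p p) != 0); last first.
  (* If the diagonal vanishes, so does the norm R_ij R_ji = R_ii R_jj of each entry. *)
  exists (fun=> 0) => i j ik jk; rewrite mul0r; apply: norm_eq0.
  have Rii0 : affine_res k (G i i) = 0.
    by apply/eqP; apply: contraT => Ri; case: nex; exists i.
  by rewrite cj_affine_res cjG // system_rank1 // Rii0 mulr0.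
(* The row of a nonzero diagonal entry R_pp: by rank one, the product of conj(v_i) and v_j is R_pp
   R_ij, a multiple of the norm R_pp. The default 0 satisfies the divisibility trivially. *)
pose v (j : 'I_n) := if (j < k)%N then affine_res k (G p j) else 0.
have [g gE] : exists g, affine_res k (G p p) = g * cj g.
  by rewrite Gii // affine_res_rayleigh.
have g0 : g != 0 by apply: contraNneq Rp0 => g0; rewrite gE g0 mul0r.
have [i j|e [eE ev]] := norm_split_vector (v := v) cjK factP g0.
  rewrite -gE /v; case: ifP => ik; last by rewrite rmorph0 mul0r; exact: divides0.
  case: ifP => jk; last by rewrite mulr0; exact: divides0.
  rewrite cj_affine_res cjG // system_rank1 //.
  exact/divides_mulr/divides_refl.
(* Writing v_j = c_j e with e of norm R_pp, cancelling R_pp leaves R_ij = conj(c_i) c_j. *)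
have [c cE] := choice ev; exists (fun j => cj (c j)) => i j ik jk.
rewrite cjK; apply: (mulfI Rp0); rewrite -system_rank1 //.
have <- : cj (affine_res k (G p i)) = affine_res k (G i p) by rewrite cj_affine_res cjG.
have vE (l : 'I_n) : (l < k)%N -> affine_res k (G p l) = c l * e by rewrite -cE /v => ->.
by rewrite (vE i) // (vE j) // gE -eE rmorphM /=; ring.
Qed.

Section Column.
Variable t : 'I_n -> P.
Hypothesis tP : forall i j : 'I_n, (i < k)%N -> (j < k)%N ->
  affine_res k (G i j) = t i * cj (t j).

Lemma column_norm (i : 'I_n) : (i < k)%N -> t i * cj (t i) = rayleigh i k.
Proof. by move=> ik; rewrite -tP // Gii // affine_res_rayleigh rayleighC. Qed.

(** This is (E) with the new index in the last place; conjugation gives the case where it comes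
    first. *)
Lemma column_system (i j : 'I_n) : (i < k)%N -> (j < k)%N ->
  G i j * t j = affine_res j (t i).
Proof.
move=> ik jk; have [->|ij] := eqVneq i j.
  by rewrite Gii // /affine_res (norm_rayleighl (column_norm jk)) mulr0 subr0.
have [tj0|tj0] := eqVneq (t j) 0.
  rewrite tj0 mulr0; apply/esym/norm_eq0.
  by rewrite (affine_res_norm _ (column_norm ik)) -(column_norm jk) tj0 mul0r mulr0.
have ctj0 : cj (t j) != 0.
  by apply: contraNneq tj0 => c0; rewrite -[t j]cjK c0 rmorph0.
have Dctj : D j (cj (t j)) = 0.
  by rewrite Dcj (norm_rayleighl (column_norm jk)) rmorph0.
have DGij : D j (G i j) = 0 := norm_rayleighr (system_norm ik jk).
have E : D j (t i) * cj (t j) = D j (D k F) * G i j - D j F * D k (G i j).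
  have := congr1 (D j) (tP ik jk).
  rewrite /affine_res raddfB /= !DM DGij Dctj (DC j k (G i j)) DGij raddf0 => E.
  transitivity (D j (t i) * cj (t j) + t i * 0); first by ring.
  by rewrite -E; ring.
(* If t j = 0 both sides vanish, by [affine_res_norm]; otherwise cj (t j) can be
   cancelled, and E eliminates the derivative of t i. *)
apply: (mulIf ctj0); rewrite -mulrA column_norm //.
transitivity (D j F * (t i * cj (t j)) - F * (D j (t i) * cj (t j))); last first.
  by rewrite /affine_res; ring.
by rewrite E -tP // /affine_res /rayleigh; ring.
Qed.

Lemma adjugate_system_extend : exists G', adjugate_system k.+1 G'.
Proof.
have ltk (i : 'I_n) : (i < k.+1)%N -> i != k -> (i < k)%N.
  by rewrite ltnS leq_eqVlt -val_eqE => /orP[->|].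
have cjDkF : cj (D k F) = D k F by rewrite -Dcj cjF.
exists (fun i j => if i == k then if j == k then D k F else cj (t j)
                   else if j == k then t i else G i j).
split.
- by move=> i ik; have [->//|ni] := eqVneq i k; rewrite Gii ?ltk.
- move=> i j /ltk ik /ltk jk; case: eqVneq => [_|ni]; case: eqVneq => [_|nj] //.
  by rewrite cjG ?ik ?jk.
move=> i j l /ltk ik /ltk jk /ltk lk.
(* The norm of [t h] is [rayleigh h k], which is constant in the k-th variable. *)
have free (h : 'I_n) : (h < k)%N -> D k (t h) = 0.
  by move=> hk; exact: norm_rayleighr (column_norm hk).
rewrite /=; have [ej|nj] := eqVneq j k; have [ei|ni] := eqVneq i k;
  have [el|nl] := eqVneq l k.
- by rewrite ej /affine_res DDF mulr0 subr0.
- by rewrite ej /affine_res Dcj free ?lk // rmorph0 mulr0 subr0.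
- by rewrite ej /affine_res free ?ik // mulr0 subr0 mulrC.
- by rewrite ej tP ?ik ?lk.
- by rewrite mulrC column_norm ?jk // affine_res_rayleigh rayleighC.
- by rewrite -cj_affine_res -column_system ?jk ?lk // rmorphM /= cjG ?jk ?lk // mulrC.
- by rewrite column_system ?ik ?jk.
- by rewrite GG ?ik ?jk ?lk.
Qed.

End Column.
End Step.

Lemma adjugate_system_exists : exists G : 'I_n -> 'I_n -> P,
  [/\ forall i, G i i = D i F, forall i j, cj (G i j) = G j i
    & forall i j l, G i j * G j l = affine_res j (G i l)].
Proof.
suff [G [G1 G2 G3]] : exists G, adjugate_system n G.
  by exists G; split=> [i|i j|i j l]; [apply: G1|apply: G2|apply: G3].
suff : forall k, (k <= n)%N -> exists G, adjugate_system k G by apply.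
elim=> [_|k IHk kn]; first by exists (fun _ _ => 0); split.
have [G GP] := IHk (ltnW kn).
have [t tP] := @system_new_column (Ordinal kn) G GP.
exact: (@adjugate_system_extend (Ordinal kn) G GP t tP).
Qed.

Lemma adjugate_system_D G : (forall i, G i i = D i F) ->
  (forall i j, cj (G i j) = G j i) ->
  (forall i j l, G i j * G j l = affine_res j (G i l)) ->
  forall i j, [/\ G i j * cj (G i j) = rayleigh i j, D i (G i j) = 0,
    D j (G i j) = 0 & forall l, D l (D l (G i j)) = 0].
Proof.
move=> G1 G2 G3 i j.
have E : G i j * cj (G i j) = rayleigh i j.
  by rewrite G2 G3 G1 affine_res_rayleigh rayleighC.
split=> // [||l].
- exact: norm_rayleighl E.
- exact: norm_rayleighr E.
- exact: norm_rayleigh2 E l.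
Qed.

End Rayleigh.

(** * Derivatives of polynomials and of determinants *)

Section MPolyCoef.
Variables (m : nat) (R : numDomainType).
Implicit Types (p q : {mpoly R[m]}) (u v : 'X_{1..m}) (l : 'I_m).

Lemma mcoeff_mderiv_subU l p v : v l != 0%N ->
  p^`M(l)@_(v - U_(l)) = p@_v *+ v l.
Proof.
move=> vl; rewrite mcoeff_mderiv submK; last first.
  by apply/mnm_lepP => i; rewrite mnm1E; case: eqP => // <-; rewrite lt0n.
by rewrite mnmBE mnm1E eqxx subn1 prednK // lt0n.
Qed.

Lemma mderiv_eq0_mcoeff l p v : p^`M(l) = 0 -> v l != 0%N -> p@_v = 0.
Proof.
move=> p0 vl; have := mcoeff_mderiv_subU p vl.
by rewrite p0 mcoeff0 => /esym/eqP; rewrite mulrn_eq0 (negPf vl) => /eqP.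
Qed.

Lemma mderiv2_eq0_mcoeff l p v : p^`M(l)^`M(l) = 0 -> (1 < v l)%N -> p@_v = 0.
Proof.
move=> p0 vl; have vl0 : v l != 0%N by case: (v l) vl.
have := mcoeff_mderiv_subU p vl0; rewrite (mderiv_eq0_mcoeff p0); last first.
  by rewrite mnmBE mnm1E eqxx subn_eq0 -ltnNge.
by move/esym/eqP; rewrite mulrn_eq0 (negPf vl0) => /eqP.
Qed.

Lemma msize_leP p d :
  (forall v, p@_v != 0 -> (mdeg v < d)%N) <-> (msize p <= d)%N.
Proof.
split=> [H|le v pv].
  by rewrite msizeE; apply/bigmax_leqP_seq => v; rewrite mcoeff_msupp => /H.
by apply: leq_trans le; apply: msize_mdeg_lt; rewrite mcoeff_msupp.
Qed.

Lemma msize_mderiv l p : (msize p^`M(l) <= (msize p).-1)%N.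
Proof.
apply/msize_leP => v; rewrite mcoeff_mderiv mulrn_eq0 => pv.
have := (msize_leP p _).2 (leqnn _) _ pv.
by rewrite mdegD mdeg1 addn1; lia.
Qed.

Lemma mpolyXM_mcoeff l p v : ('X_l * p)@_(v + U_(l)) = p@_v.
Proof. by rewrite mulrC addmC mcoeffMX. Qed.

Lemma mpolyXM_mcoeff0 l p v : v l = 0%N -> ('X_l * p)@_v = 0.
Proof.
move=> vl; apply/eqP; rewrite mcoeff_eq0 mulrC (perm_mem (msuppMX _ _)).
by apply/mapP => -[u _ E]; move: vl; rewrite E mnmDE mnm1E eqxx.
Qed.

(** Unlike the derivative, the Euler operator keeps every monomial in place, which makes leading
    monomials comparable. *)
Lemma euler_mcoeff l p v : ('X_l * p^`M(l))@_v = p@_v *+ v l.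
Proof.
have [vl|vl] := eqVneq (v l) 0%N; first by rewrite mpolyXM_mcoeff0 // vl mulr0n.
rewrite -mcoeff_mderiv_subU // -(mpolyXM_mcoeff l _ (v - U_(l))) submK //.
by apply/mnm_lepP => i; rewrite mnm1E; case: eqP => // <-; rewrite lt0n.
Qed.

Lemma mlead_le p u : (forall v, p@_v != 0 -> (v <= u)%O) -> (mlead p <= u)%O.
Proof.
move=> H; have [->|p0] := eqVneq p 0; first by rewrite mlead0 le0x.
by apply: H; rewrite mleadc_eq0.
Qed.

Lemma mlead_euler l p : (mlead ('X_l * p^`M(l)) <= mlead p)%O.
Proof.
apply: mlead_le => v; rewrite euler_mcoeff mulrn_eq0 negb_or => /andP[_ pv].
by apply: msupp_le_mlead; rewrite mcoeff_msupp.
Qed.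

Lemma mderivXU (i j : 'I_m) : ('X_i : {mpoly R[m]})^`M(j) = (i == j)%:R%:MP.
Proof.
rewrite mderivX mnm1E; case: eqVneq => [->|_]; last by rewrite scale0r mpolyC0.
by rewrite scale1r -[X in (X - _)%MM]add0m addmK mpolyX0.
Qed.

Lemma msizeM_leq p q a b : (msize p <= a.+1)%N -> (msize q <= b.+1)%N ->
  (msize (p * q) <= (a + b).+1)%N.
Proof.
move=> pa qb; have [->|p0] := eqVneq p 0; first by rewrite mul0r msize0.
have [->|q0] := eqVneq q 0; first by rewrite mulr0 msize0.
rewrite msizeM //; move: pa qb.
by move: (mmeasure _ p) (mmeasure _ q) => x y; lia.
Qed.

Lemma msize_sum_leq (I : Type) (r : seq I) (Q : pred I) (F : I -> {mpoly R[m]}) d :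
  (forall i, Q i -> (msize (F i) <= d)%N) -> (msize (\sum_(i <- r | Q i) F i) <= d)%N.
Proof.
move=> H; elim/big_rec: _ => [|i p Qi IH]; first by rewrite msize0.
by rewrite (leq_trans (mmeasureD_le _ _ _)) // geq_max H.
Qed.

End MPolyCoef.

Section Derivations.
Variables (P : comNzRingType) (n : nat) (D : 'I_n -> {additive P -> P}).
Hypothesis DM : forall i p q, D i (p * q) = D i p * q + p * D i q.

Lemma deriv_prod0 (l : 'I_n) (I : Type) (r : seq I) (Q : pred I) (p : I -> P) :
  (forall i, Q i -> D l (p i) = 0) -> D l (\prod_(i <- r | Q i) p i) = 0.
Proof.
move=> H; elim/big_rec: _ => [|i q Qi IH]; last by rewrite DM H // IH mul0r mulr0 addr0.
have /eqP := DM l 1 1; rewrite !mulr1 mul1r -subr_eq0 opprD addrA subrr add0r.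
by rewrite oppr_eq0 => /eqP.
Qed.

Lemma deriv_signr l (b : bool) p : D l ((-1) ^+ b * p) = (-1) ^+ b * D l p.
Proof. by case: b; rewrite ?expr1 ?expr0 ?mulN1r ?mul1r ?raddfN. Qed.

Lemma deriv_det0 (l : 'I_n) k (B : 'M[P]_k) :
  (forall i j, D l (B i j) = 0) -> D l (\det B) = 0.
Proof.
move=> H; rewrite raddf_sum big1 // => s _.
by rewrite deriv_signr deriv_prod0 ?mulr0.
Qed.

Lemma deriv_mulmx l a b c (A : 'M[P]_(a, b)) (B : 'M[P]_(b, c)) :
  map_mx (D l) (A *m B) = map_mx (D l) A *m B + A *m map_mx (D l) B.
Proof.
apply/matrixP => i j; rewrite !mxE raddf_sum -big_split /=.
by apply: eq_bigr => k _; rewrite DM !mxE.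
Qed.

Section Pencil.
Variable N : 'M[P]_n.
Hypothesis DN : forall l, map_mx (D l) N = delta_mx l l.

(* Jacobi's formula: differentiating along the l-th diagonal entry only. *)
Lemma deriv_det l : D l (\det N) = (\adj N) l l.
Proof.
have DNE i j : D l (N i j) = ((i == l) && (j == l))%:R.
  by have /matrixP/(_ i j) := DN l; rewrite !mxE.
rewrite (expand_det_row N l) raddf_sum (bigD1 l) //= big1 ?addr0 => [|j jl].
  rewrite DM DNE eqxx mul1r /cofactor -signr_odd deriv_signr deriv_det0 => [|i j].
    by rewrite !mulr0 addr0 mxE /cofactor signr_odd.
  by rewrite !mxE DNE eq_sym (negPf (neq_lift l i)).
rewrite DM DNE (negPf jl) andbF mul0r add0r /cofactor -signr_odd deriv_signr.
by rewrite deriv_det0 ?mulr0 // => i h; rewrite !mxE DNE eq_sym (negPf (neq_lift l i)).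
Qed.

Lemma mul_delta_mx2 (A B : 'M[P]_n) (i j k : 'I_n) :
  (A *m delta_mx j j *m B) i k = A i j * B j k.
Proof.
rewrite -(mul_delta_mx (0 : 'I_1)) mulmxA -colE -mulmxA -rowE mxE big_ord1.
by rewrite !mxE.
Qed.

(** Differentiate N adj N = det N and multiply by adj N on the left. *)
Lemma deriv_adj l : \det N *: map_mx (D l) (\adj N) =
  (\adj N) l l *: \adj N - \adj N *m delta_mx l l *m \adj N.
Proof.
have := congr1 (map_mx (D l)) (mul_mx_adj N).
rewrite deriv_mulmx DN => /(congr1 (mulmx (\adj N))).
rewrite mulmxDr !mulmxA mul_adj_mx mul_scalar_mx => /(canRL (addKr _)) ->.
rewrite addrC; congr (_ - _).
have -> : map_mx (D l) ((\det N)%:M : 'M_n) = (D l (\det N))%:M.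
  by apply/matrixP => i j; rewrite !mxE raddfMn.
by rewrite mul_mx_scalar deriv_det.
Qed.

Lemma adj_system i j l : (\adj N) i j * (\adj N) j l =
  D j (\det N) * (\adj N) i l - \det N * D j ((\adj N) i l).
Proof.
have E : \adj N *m delta_mx j j *m \adj N =
    (\adj N) j j *: \adj N - \det N *: map_mx (D j) (\adj N).
  by rewrite deriv_adj subKr.
rewrite deriv_det -mul_delta_mx2 E; move: (\adj N) (\det N) => G d.
by rewrite !mxE.
Qed.

(** In matrix form the hypothesis reads F D_j G = D_j F G - G E_jj G; it is substituted into F times
    the derivative of N G - F. *)
Lemma pencil_defect (G : 'M[P]_n) (F : P) :
  (forall i j l, G i j * G j l = D j F * G i l - F * D j (G i l)) ->
  forall i j k, F * D j ((N *m G - F%:M) i k) =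
    D j F * (N *m G - F%:M) i k - (N *m G - F%:M) i j * G j k.
Proof.
move=> GP i j k; set M := N *m G - F%:M.
have subE (A B : 'M[P]_n) a b : (A - B) a b = A a b - B a b by rewrite !mxE.
have scaleE c (A : 'M[P]_n) a b : (c *: A) a b = c * A a b by rewrite mxE.
have mapE l (A : 'M[P]_n) a b : map_mx (D l) A a b = D l (A a b) by rewrite mxE.
have dG : F *: map_mx (D j) G = D j F *: G - G *m delta_mx j j *m G.
  by apply/matrixP => a b; rewrite subE !scaleE mapE mul_delta_mx2 GP subKr.
have dM : map_mx (D j) M = delta_mx j j *m G + N *m map_mx (D j) G - (D j F)%:M.
  rewrite -DN -deriv_mulmx; apply/matrixP => a b.
  by rewrite subE !mapE subE raddfB /= [F%:M a b]mxE [(D j F)%:M a b]mxE raddfMn.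
suff : F *: map_mx (D j) M = D j F *: M - M *m delta_mx j j *m G.
  by move/(congr1 (fun X : 'M_n => X i k)); rewrite subE !scaleE mapE mul_delta_mx2.
rewrite dM scalerBr scalerDr -mulmxA [X in _ + X - _]scalemxAr dG.
rewrite /M !mulmxBl scalerBr mulmxBr !mulmxA mul_scalar_mx -!scalemxAr -!scalemxAl.
have -> : F *: (D j F)%:M = D j F *: F%:M :> 'M_n by rewrite !scale_scalar_mx mulrC.
by rewrite opprB addrCA addrAC.
Qed.

End Pencil.
End Derivations.

(** * Leading monomials *)

Section Leading.
Variables (R : numDomainType) (m n : nat) (hnm : (n <= m)%N).
Local Notation P := {mpoly R[m]}.
Local Notation w := (widen_ord hnm).
Implicit Types (p q F : P) (u v : 'X_{1..m}) (l : 'I_n).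

(** The exponent of x_1 ... x_n. *)
Definition mtop : 'X_{1..m} := [multinom ((i < n)%N : nat) | i < m].

Lemma mtopE l : mtop (w l) = 1%N.
Proof. by rewrite mnmE /= ltn_ord. Qed.

Lemma widenP (i : 'I_m) : (i < n)%N -> exists l, i = w l.
Proof. by move=> lti; exists (Ordinal lti); apply: val_inj. Qed.

Lemma widen_ord_inj : injective w.
Proof. by move=> i j /(congr1 val) /= ij; apply: val_inj. Qed.

Lemma mdeg_mtop : mdeg mtop = n.
Proof.
rewrite mdegE (eq_bigr (fun i : 'I_m => if (i < n)%N then 1%N else 0%N)); last first.
  by move=> i _; rewrite mnmE; case: (_ < _)%N.
by rewrite -big_mkcond -(big_ord_widen m (fun=> 1%N)) // sum1_card card_ord.
Qed.

Lemma mtop_le u : (forall l, u (w l) = 1%N) -> (mtop <= u)%MM.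
Proof.
move=> H; apply/mnm_lepP => i; rewrite mnmE; case: ltnP => // lti.
by have [l ->] := widenP lti; rewrite H.
Qed.

Lemma eq_mtop u : (forall l, u (w l) = 1%N) -> (mdeg u <= n)%N -> u = mtop.
Proof.
move=> /mtop_le le du; rewrite -(submK le).
suff -> : (u - mtop)%MM = 0%MM by rewrite add0m.
apply/eqP; rewrite -mdeg_eq0; move: du; rewrite -{1}(submK le) mdegD mdeg_mtop.
by rewrite -{2}[n]add0n leq_add2r leqn0.
Qed.

(* [mtop] is the largest monomial of degree at most n that is multiaffine in
   the first n variables, the order being graded lexicographic. *)
Lemma mlead_le_mtop p : (forall l, p^`M(w l)^`M(w l) = 0) ->
  (msize p <= n.+1)%N -> (mlead p <= mtop)%O.
Proof.
move=> p2 sp; apply: mlead_le => v pv.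
have vn : (mdeg v <= n)%N by rewrite -ltnS; exact: (msize_leP p n.+1).2.
have v1 l : (v (w l) <= 1)%N.
  by rewrite leqNgt; apply: contraNN pv => /(mderiv2_eq0_mcoeff (p2 l)) ->.
have [ltv|] := ltnP (mdeg v) n; first by rewrite ltW // lt_mdeg_ltmc // mdeg_mtop.
move=> nv; have ev : mdeg mtop = mdeg v by apply/eqP; rewrite mdeg_mtop eqn_leq nv vn.
rewrite leNgt; apply/negP => ltv; case/(ltmcP ev): (ltv) => i eqv lti.
have [ltin|nlei] := ltnP i n.
  have [l il] := widenP ltin; move: lti; rewrite il mtopE.
  by rewrite ltnNge v1.
have vE : v = mtop.
  apply: eq_mtop => // l; rewrite -eqv ?mtopE //=.
  exact: leq_trans (ltn_ord l) nlei.
by move: ltv; rewrite vE ltxx.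
Qed.

(** * Rigidity of the differential equations by leading monomials *)

Section LeadEquation.
Variable F : P.
Hypotheses (sF : (msize F <= n.+1)%N) (FDD : forall l, F^`M(w l)^`M(w l) = 0).
Hypothesis F1 : F@_mtop = 1.

(** Multiply the equation by x_l and take the coefficient at [mtop + mlead p]. The left side gives
    the leading coefficient of [p] times its exponent in x_l, the right side gives it once. *)
Lemma mlead_exponent1 l p q : p != 0 ->
  F * p^`M(w l) = F^`M(w l) * p - q -> ('X_(w l) * q)@_(mtop + mlead p) = 0 ->
  mlead p (w l) = 1%N.
Proof.
move=> p0 E q0; set u := mlead p in q0 *.
have leF := mlead_le_mtop FDD sF.
have := congr1 (fun r => ('X_(w l) * r)@_(mtop + u)) E.
rewrite /= mulrBr mcoeffB q0 subr0 [in LHS]mulrCA [in RHS]mulrA.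
rewrite (mleadcMW leF (mlead_euler _ _)) F1 mul1r euler_mcoeff.
rewrite (mleadcMW (le_trans (mlead_euler _ _) leF) (lexx u)) euler_mcoeff.
rewrite F1 mtopE mul1r => /eqP.
rewrite -mulr_natr -subr_eq0 -{2}[p@_u]mulr1 -mulrBr mulf_eq0 mleadc_eq0.
by rewrite (negPf p0) subr_eq0 /= pnatr_eq1 => /eqP.
Qed.

(** [M] is one row of the defect. The largest leading monomial in the row, at position k, is forced
    to be x_1 ... x_n / x_k times a monomial of degree at most one in the remaining variables, where
    the coefficient vanishes by assumption. *)
Lemma pencil_rigid (M : 'I_n -> P) (G : 'I_n -> 'I_n -> P) :
  (forall j k, F * (M k)^`M(w j) = F^`M(w j) * M k - M j * G j k) ->
  (forall k, (msize (M k) <= n.+1)%N) ->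
  (forall j k, (msize (G j k) <= n)%N) -> (forall k, G k k = F^`M(w k)) ->
  (forall j k, (G j k)^`M(w j) = 0) -> (forall j k, (G j k)^`M(w k) = 0) ->
  (forall j k l, (G j k)^`M(w l)^`M(w l) = 0) ->
  (forall k u, (forall l, u (w l) = 0%N) -> (mdeg u <= 1)%N ->
     (M k)@_(mtop - U_(w k) + u) = 0) ->
  forall k, M k = 0.
Proof.
move=> eqM sM sG Gkk Gl Gr G2 cM k0; apply/eqP; apply: contraT => Mk0.
case: (@arg_maxP _ _ _ k0 (fun k => M k != 0) (fun k => mlead (M k)) Mk0).
move=> k Mk kmax; set u := mlead (M k) in kmax *.
have le j : (mlead (M j) <= u)%O.
  have [->|Mj] := eqVneq (M j) 0; first by rewrite mlead0 le0x.
  exact: kmax.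
(* For j = k the right side of [eqM] cancels, so x_k does not occur in M_k. *)
have uk : u (w k) = 0%N.
  apply/eqP; apply: contraT => uk.
  have dM0 : (M k)^`M(w k) = 0.
    have := eqM k k; rewrite Gkk [M k * _]mulrC subrr => /eqP.
    rewrite mulf_eq0 => /orP[/eqP F0|/eqP//].
    by move: F1; rewrite F0 mcoeff0 => /eqP; rewrite eq_sym oner_eq0.
  by move: Mk; rewrite -mleadc_eq0 -/u (mderiv_eq0_mcoeff dM0 uk) eqxx.
have u1 j : j != k -> u (w j) = 1%N.
  move=> jk; apply: (mlead_exponent1 Mk (eqM j k)); rewrite mulrCA addmC.
  rewrite mleadcMW ?le //; last first.
    apply: mlead_le_mtop => [l|]; last first.
      have n0 : (0 < n)%N := leq_ltn_trans (leq0n _) (ltn_ord j).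
      have := @msizeM_leq _ _ 'X_(w j) (G j k) 1 n.-1.
      by rewrite add1n prednK // msizeX mdeg1; apply.
    rewrite !(mderivM, mderivD) !G2 mulr0 !addr0 mderivXU mderivC mul0r add0r.
    have [/widen_ord_inj <-|_] := eqVneq (w j) (w l); first by rewrite Gl !mulr0 addr0.
    by rewrite mpolyC0 !mul0r addr0.
  (* Neither x_j nor G_jk involves x_k, whereas [mtop] does. *)
  have -> : ('X_(w j) * G j k)@_mtop = 0; last by rewrite mulr0.
  apply: (@mderiv_eq0_mcoeff _ _ (w k)); last by rewrite mtopE.
  rewrite mderivM Gr mulr0 addr0 mderivXU.
  by rewrite (inj_eq widen_ord_inj) (negPf jk) mpolyC0 mul0r.
have Ule : (U_(w k) <= mtop)%MM.
  by apply/mnm_lepP => i; rewrite mnm1E; case: eqP => // <-; rewrite mtopE.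
have topE l : (mtop - U_(w k))%MM (w l) = u (w l).
  rewrite mnmBE mtopE mnm1E (inj_eq widen_ord_inj).
  by have [<-|kl] := eqVneq k l; rewrite ?uk // u1 // eq_sym.
have leu : (mtop - U_(w k) <= u)%MM.
  apply/mnm_lepP => i; have [/widenP[l ->]|lei] := ltnP i n; first by rewrite topE.
  by rewrite mnmBE mnmE ltnNge lei.
have := cM k (u - (mtop - U_(w k)))%MM; rewrite addmC submK // => uM.
move: (Mk); rewrite -mleadc_eq0 -/u uM ?eqxx // => [l|].
  by rewrite mnmBE topE subnn.
have := (msize_leP (M k) n.+1).2 (sM k) u.
rewrite mleadc_eq0 => /(_ Mk); rewrite ltnS -{1}(submK leu) mdegD.
have : mdeg (mtop - U_(w k))%MM = n.-1.
  have := mdeg_mtop; rewrite -{1}(submK Ule) mdegD mdeg1; lia.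
by move=> ->; lia.
Qed.

(** The leading monomial of a nonzero [p] would have exponent 1 in each of x_1, ..., x_n, hence be
    [mtop] by degree. *)
Lemma proportional_rigid p : (forall l, F * p^`M(w l) = F^`M(w l) * p) ->
  (msize p <= n.+1)%N -> p@_mtop = 0 -> p = 0.
Proof.
move=> eqp sp p1; apply/eqP; apply: contraT => p0.
move: (p0); rewrite -mleadc_eq0 (@eq_mtop (mlead p)) ?p1 ?eqxx // => [l|].
  by apply: (@mlead_exponent1 l p 0); rewrite ?subr0 // mulr0 mcoeff0.
by have := (msize_leP p n.+1).2 sp (mlead p); rewrite mleadc_eq0 ltnS => ->.
Qed.

End LeadEquation.
End Leading.

(** * Affine Hermitian pencils *)

Lemma map_mpoly_mderiv (m : nat) (K L : nzRingType) (h : {additive K -> L})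
    (i : 'I_m) (p : {mpoly K[m]}) :
  map_mpoly h p^`M(i) = (map_mpoly h p)^`M(i).
Proof.
by apply/mpolyP => u; rewrite mcoeff_mderiv !mcoeff_map_mpoly mcoeff_mderiv raddfMn.
Qed.

Section Pencil.
Variables (C : numClosedFieldType) (m n : nat) (hnm : (n <= m)%N).
Local Notation P := {mpoly C[m]}.
Local Notation w := (widen_ord hnm).

Definition xderiv : 'I_n -> {additive P -> P} := fun l => mderiv (w l).
Definition xconj : {rmorphism P -> P} := map_mpoly (Num.conj : {rmorphism C -> C}).


Lemma xderivE l p : xderiv l p = p^`M(w l). Proof. by []. Qed.

Lemma mcoeff_xconj p u : (xconj p)@_u = (p@_u)^*.
Proof. exact: mcoeff_map_mpoly. Qed.

Lemma xconjK : involutive xconj.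
Proof. by move=> p; apply/mpolyP => u; rewrite !mcoeff_xconj conjCK. Qed.

Lemma xderivM l p q : xderiv l (p * q) = xderiv l p * q + p * xderiv l q.
Proof. exact: mderivM. Qed.

Lemma xderivC i j p : xderiv i (xderiv j p) = xderiv j (xderiv i p).
Proof. exact: mderiv_comm. Qed.

Lemma xderiv_conj l p : xderiv l (xconj p) = xconj (xderiv l p).
Proof. by rewrite !xderivE /xconj /= map_mpoly_mderiv. Qed.

Lemma mpoly_char0 k : k.+1%:R != 0 :> P.
Proof. by rewrite -mpolyC_nat mpolyC_eq0 pnatr_eq0. Qed.

Lemma xderiv_nilpotent l p : exists k, iter k (xderiv l) p = 0.
Proof.
exists (msize p); apply/eqP; rewrite -msize_poly_eq0 -leqn0.
suff H k : (msize (iter k (xderiv l) p) <= msize p - k)%N.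
  by have := H (msize p); rewrite subnn.
elim: k => [|k IHk]; first by rewrite subn0.
by rewrite iterS xderivE (leq_trans (msize_mderiv _ _)) // subnS -!subn1 leq_sub2r.
Qed.

Section Affine.
Variables (A : 'I_m -> 'M[C]_n) (A0 : 'M[C]_n).

Definition pencil : 'M[P]_n :=
  diag_mx (\row_(i < n) 'X_(w i))
  + \sum_(j < m | (n <= j)%N) 'X_j *: mpolyC_mx m (A j) + mpolyC_mx m A0.

Definition affine_part i k : P :=
  \sum_(j < m | (n <= j)%N) A j i k *: 'X_j + (A0 i k)%:MP.

Lemma pencilE i k : pencil i k = 'X_(w i) *+ (i == k) + affine_part i k.
Proof.
rewrite !mxE -addrA; congr (_ + (_ + _)).
rewrite summxE; apply: eq_bigr => j _.
by rewrite !mxE mulrC mul_mpolyC.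
Qed.

Lemma xderiv_affine_part l i k : xderiv l (affine_part i k) = 0.
Proof.
rewrite raddfD /= mderivC addr0 raddf_sum big1 // => j nj /=.
rewrite mderivZ mderivXU; case: eqP => [E|_]; last by rewrite mpolyC0 scaler0.
by move: nj; rewrite E /= leqNgt ltn_ord.
Qed.

Lemma xderiv_pencil l : map_mx (xderiv l) pencil = delta_mx l l.
Proof.
apply/matrixP => i k; rewrite [LHS]mxE pencilE raddfD /= [X in _ + X]xderiv_affine_part.
rewrite addr0 raddfMn /= mderivXU (inj_eq (@widen_ord_inj _ _ hnm)) mxE.
have [->|nil] := eqVneq i l; last by rewrite mpolyC0 mul0rn.
by rewrite mpolyC1 eq_sym.
Qed.

Lemma msize_affine_part i k : (msize (affine_part i k) <= 2)%N.
Proof.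
rewrite (leq_trans (mmeasureD_le _ _ _)) // geq_max; apply/andP; split.
  apply: msize_sum_leq => j _; rewrite (leq_trans (msizeZ_le _ _)) //.
  by rewrite msizeX mdeg1.
by rewrite mmeasureC; case: eqP.
Qed.

Lemma msize_pencil i k : (msize (pencil i k) <= 2)%N.
Proof.
rewrite pencilE (leq_trans (mmeasureD_le _ _ _)) // geq_max msize_affine_part andbT.
by case: eqP; rewrite ?mulr1n ?msizeX ?mdeg1 // mulr0n msize0.
Qed.

Lemma msize_det_pencil : (msize (\det pencil) <= n.+1)%N.
Proof.
apply: msize_sum_leq => s _.
have H : (msize (\prod_i pencil i (s i)) <= n.+1)%N.
  rewrite -[n in n.+1]card_ord -sum1_card.
  elim/big_rec2: _ => [|i p d _ IH]; first by rewrite msize1.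
  exact: msizeM_leq (msize_pencil i (s i)) IH.
by case: (odd_perm s); rewrite ?expr1 ?expr0 ?mulN1r ?mul1r ?mmeasureN.
Qed.

(** Among monomials of degree one, the order places x_1, ..., x_n above the later variables. Hence
    x_i leads the i-th diagonal entry of the pencil. *)
Lemma mlead_affine_part i k l : (mlead (affine_part i k) < U_(w l)%MM)%O.
Proof.
set p := affine_part i k; set v := mlead p.
have [v0|v0] := eqVneq (mdeg v) 0%N; first by rewrite lt_mdeg_ltmc // v0 mdeg1.
have pv : p@_v != 0.
  by rewrite mleadc_eq0; apply: contraNneq v0 => p0; rewrite /v p0 mlead0 mdeg0.
have vD l' : v (w l') = 0%N.
  apply/eqP; apply: contraNT pv => vl.
  by rewrite (mderiv_eq0_mcoeff (xderiv_affine_part l' i k) vl).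
have v1 : mdeg v == 1%N.
  by have := (msize_leP p 2).2 (msize_affine_part i k) v pv; move: v0; case: mdeg => [|[]].
have [j /eqP vj] := mdeg1P _ v1; rewrite vj in vD *.
apply/ltmcP; first by rewrite !mdeg1.
exists (w l) => [j' /= ltj'|]; last by rewrite vD mnm1E eqxx.
have [l' j'E] := @widenP _ _ hnm j' (ltn_trans ltj' (ltn_ord l)).
rewrite j'E vD mnm1E; case: eqP => // E; move: ltj'.
by rewrite j'E -E ltnn.
Qed.

Lemma mcoeff_det_pencil : (\det pencil)@_(mtop m n) = 1.
Proof.
rewrite /determinant (bigD1 1%g) //= mcoeffD raddf_sum /=.
rewrite [X in _ + X]big1 ?addr0 => [|s s1].
  rewrite odd_perm1 expr0 mul1r.
  have lead i : mlead (pencil i ((1 : 'S_n)%g i)) = U_(w i)%MM.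
    by rewrite perm1 pencilE eqxx mulr1n mleadDl mleadXm // mlead_affine_part.
  have -> : mtop m n = (\sum_(i < n) mlead (pencil i ((1 : 'S_n)%g i)))%MM.
    apply/mnmP => j; rewrite mnm_sumE (eq_bigr (fun i => U_(w i)%MM j)) => [|i _].
      have [/(widenP hnm)[l ->]|nj] := ltnP j n.
        rewrite mtopE (bigD1 l) //= mnm1E eqxx big1 // => i il.
        by rewrite mnm1E (inj_eq (@widen_ord_inj _ _ hnm)) (negPf il).
      rewrite mnmE ltnNge nj big1 // => i _; rewrite mnm1E.
      by case: eqP nj => // <-; rewrite /= leqNgt ltn_ord.
    by rewrite lead.
  rewrite mleadc_prod big1 // => i _.
  rewrite lead perm1 pencilE eqxx mulr1n mcoeffD mcoeffX eqxx.
  by rewrite mcoeff_gt_mlead ?addr0 // mlead_affine_part.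
(* The variable x_l occurs only in the entry (l, l), which the product for [s] avoids. *)
have [l sl] : exists l, s l != l.
  apply/existsP; apply: contraR s1; rewrite negb_exists => /forallP H.
  by apply/eqP/permP => l; rewrite perm1; apply/eqP; have := H l; rewrite negbK.
apply: (@mderiv_eq0_mcoeff _ _ (w l)); last by rewrite mtopE.
rewrite -xderivE (deriv_signr xderiv) (deriv_prod0 xderivM) ?mulr0 // => i _.
have /matrixP/(_ i (s i)) := xderiv_pencil l; rewrite !mxE => ->.
by have [->|] := eqVneq i l; rewrite ?(negPf sl).
Qed.

Hypotheses (hA : forall j : 'I_m, (n <= j)%N -> A j \is hermsymmx).
Hypothesis hA0 : A0 \is hermsymmx.

Lemma hermsymmx_entry (B : 'M[C]_n) i k : B \is hermsymmx -> (B i k)^* = B k i.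
Proof.
move/is_hermitianmxP; rewrite expr0 scale1r => E.
by rewrite {2}E !mxE.
Qed.

Lemma xconj_pencil : map_mx xconj pencil = pencil^T.
Proof.
apply/matrixP => i k; rewrite [LHS]mxE [RHS]mxE !pencilE rmorphD /= raddfMn /=.
rewrite /xconj /= map_mpolyX; congr (_ + _).
  by rewrite eq_sym; case: eqP => [->|].
rewrite rmorphD rmorph_sum /= map_mpolyC /= hermsymmx_entry //; congr (_ + _).
by apply: eq_bigr => j nj; rewrite map_mpolyZ map_mpolyX /= hermsymmx_entry ?hA.
Qed.

Lemma xconj_adj_pencil i k : xconj ((\adj pencil) i k) = (\adj pencil) k i.
Proof.
by have := map_mx_adj xconj pencil; rewrite xconj_pencil -trmx_adj => /matrixP/(_ i k);
  rewrite !mxE.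
Qed.

End Affine.
End Pencil.

(** * From a solution of (E) to a Hermitian pencil, and back *)

Section Representation.
Variables (C : numClosedFieldType) (m n : nat) (hnm : (n <= m)%N).
Local Notation P := {mpoly C[m]}.
Local Notation w := (widen_ord hnm).
Local Notation D := (@xderiv C m n hnm).
Local Notation cj := (@xconj C m).

Lemma rayleigh_det_pencil (A : 'I_m -> 'M[C]_n) (A0 : 'M[C]_n) i j :
  (forall j : 'I_m, (n <= j)%N -> A j \is hermsymmx) -> A0 \is hermsymmx ->
  let N := pencil hnm A A0 in
  rayleigh D (\det N) i j = (\adj N) i j * cj ((\adj N) i j).
Proof.
move=> hA hA0 N; rewrite xconj_adj_pencil //.
rewrite (adj_system (@xderivM C m n hnm) (@xderiv_pencil C m n hnm A A0)).
rewrite -(deriv_det (@xderivM C m n hnm) (@xderiv_pencil C m n hnm A A0)).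
by rewrite /rayleigh xderivC mulrC.
Qed.

Variable F : P.
Hypotheses (cjF : cj F = F) (DDF : forall l, D l (D l F) = 0).
Hypotheses (sF : (msize F <= n.+1)%N) (F1 : F@_(mtop m n) = 1).

Variable G : 'I_n -> 'I_n -> P.
Hypotheses (Gii : forall i, G i i = D i F) (cjG : forall i j, cj (G i j) = G j i).
Hypothesis GG : forall i j l, G i j * G j l = affine_res D F j (G i l).

Lemma msize_xconj p : msize (cj p) = msize p.
Proof.
have H q : (msize (cj q) <= msize q)%N.
  apply/msize_leP => v; rewrite mcoeff_xconj conjC_eq0.
  exact: (msize_leP q _).2 (leqnn _) v.
by apply/eqP; rewrite eqn_leq H -{1}[p]xconjK H.
Qed.

Let GP i j : [/\ G i j * cj (G i j) = rayleigh D F i j, D i (G i j) = 0,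
    D j (G i j) = 0 & forall l, D l (D l (G i j)) = 0].
Proof.
exact: (adjugate_system_D (@xconjK C m) (@mpoly_char0 C m) (@xderivM C m n hnm)
  (@xderivC C m n hnm) (@xderiv_conj C m n hnm) (@xderiv_nilpotent C m n hnm)
  DDF Gii cjG GG).
Qed.

(** The Rayleigh difference has total degree at most 2(n - 1) and is the norm of the entry, whose
    degree is half of that. *)
Lemma msize_adjugate i j : (msize (G i j) <= n)%N.
Proof.
have n0 : (0 < n)%N := leq_ltn_trans (leq0n _) (ltn_ord i).
have sD l p k : (msize p <= k)%N -> (msize (D l p) <= k.-1)%N.
  move=> pk; rewrite (leq_trans (msize_mderiv _ _)) //.
  by rewrite -!subn1 leq_sub2r.
have sDF l : (msize (D l F) <= n.-1.+1)%N by rewrite prednK // (sD l F n.+1).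
have srayleigh : (msize (rayleigh D F i j) <= (n.-1 + n.-1).+1)%N.
  rewrite (leq_trans (mmeasureD_le _ _ _)) // geq_max mmeasureN msizeM_leq ?sDF //=.
  have [->|d0] := eqVneq (D i (D j F)) 0; first by rewrite mulr0 msize0.
  have sDD : (msize (D i (D j F)) <= n.-1)%N := sD i _ n.-1.+1 (sDF j).
  have n1 : (1 < n)%N.
    rewrite -subn_gt0 subn1 (leq_trans _ sDD) // lt0n.
    by rewrite msize_poly_eq0.
  (* With truncated predecessors this needs 1 < n, which holds because the mixed derivative is
     nonzero. *)
  have -> : (n.-1 + n.-1 = n + n.-2)%N by lia.
  by apply: msizeM_leq => //; rewrite (leq_trans sDD) // leqSpred.
have [Gn _ _ _] := GP i j.
have [->|g0] := eqVneq (G i j) 0; first by rewrite msize0.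
move: srayleigh; rewrite -Gn msizeM ?msize_xconj //; last first.
  by rewrite -msize_poly_eq0 msize_xconj msize_poly_eq0.
by move: (mmeasure _ _) n0 => x; lia.
Qed.

(* The defect of the pencil is S + B G, with B the affine part, and the entry
   (i, k) of B G has the leading part B_ik x_1 ... x_n / x_k; [Acoef u] is what B
   must be for the multiple u of x_1 ... x_n / x_k to vanish in the defect. *)
Let S i k : P := 'X_(w i) * G i k - F *+ (i == k).

Let Acoef (u : 'X_{1..m}) : 'M[C]_n :=
  \matrix_(i, k) - (S i k)@_(mtop m n - U_(w k) + u).

(** Off the diagonal, the coefficient read from x_i G_ik is that of G_ik at x_1 ... x_n u / (x_i
    x_k), a monomial symmetric in i and k; [G] itself is Hermitian. *)
Lemma Acoef_herm (u : 'X_{1..m}) : (forall l, u (w l) = 0%N) -> Acoef u \is hermsymmx.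
Proof.
move=> u0; apply/is_hermitianmxP; rewrite expr0 scale1r; apply/matrixP => k i.
rewrite !mxE rmorphN /=; congr (- _).
rewrite -mcoeff_xconj /S rmorphB /= rmorphM /= rmorphMn /= cjG cjF.
have -> : cj 'X_(w i) = 'X_(w i) by rewrite /cj /= map_mpolyX.
have [->//|nik] := eqVneq i k.
rewrite !mulr0n !subr0.
have E (a b : 'I_n) : a != b -> (mtop m n - U_(w b) + u =
    (mtop m n - U_(w b) - U_(w a) + u) + U_(w a))%MM.
  move=> ab; apply/mnmP => j; rewrite !(mnmDE, mnmBE) !mnm1E.
  have [<-|_] := eqVneq (w a) j; last by rewrite subn0 addn0.
  by rewrite mtopE (inj_eq (@widen_ord_inj _ _ hnm)) eq_sym (negPf ab) u0.
have comm : (mtop m n - U_(w i) - U_(w k) = mtop m n - U_(w k) - U_(w i))%MM.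
  by apply/mnmP => j; rewrite !mnmBE subnAC.
rewrite (E k i) 1?eq_sym // mpolyXM_mcoeff (E i k) // mpolyXM_mcoeff.
by rewrite comm.
Qed.

Let A (j : 'I_m) := Acoef U_(j).
Let A0 := Acoef 0.
Let N := pencil hnm A A0.

(** Indexing [B] by exponents treats the constant matrix and the coefficients of the x_j alike. *)
Lemma mcoeff_affine_mul (B : 'X_{1..m} -> 'M[C]_n) i k h (u : 'X_{1..m}) :
  (forall l, u (w l) = 0%N) -> (mdeg u <= 1)%N ->
  (affine_part (fun j => B U_(j)%MM) (B 0%MM) i k * D h F)@_(mtop m n - U_(w h) + u)
    = B u i k.
Proof.
move=> u0 du; rewrite /affine_part mulrDl mulr_suml mcoeffD raddf_sum /= mcoeffCM.
under eq_bigr => j _ do rewrite -scalerAl mcoeffZ.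
have Uh : (U_(w h) <= mtop m n)%MM.
  by apply/mnm_lepP => j; rewrite mnm1E; case: eqP => // <-; rewrite mtopE.
(* This is the coefficient of [F] at x_1 ... x_n times v, which exceeds degree n unless v is
   trivial. *)
have Fh (v : 'X_{1..m}) : (forall l, v (w l) = 0%N) ->
    (D h F)@_(mtop m n - U_(w h) + v) = (v == 0%MM)%:R.
  move=> v0; rewrite xderivE mcoeff_mderiv !(mnmDE, mnmBE) mtopE mnm1E eqxx v0 mulr1n.
  rewrite -addmA [(v + _)%MM]addmC addmA submK //.
  have [->|nv] := eqVneq v 0%MM; first by rewrite addm0 F1.
  apply/eqP; apply: contraT => Fv; have := (msize_leP F _).2 sF _ Fv.
  by rewrite mdegD mdeg_mtop // ltnS -{2}[n]addn0 leq_add2l leqn0 mdeg_eq0 (negPf nv).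
have top0 (j : 'I_m) : (n <= j)%N -> (mtop m n - U_(w h))%MM j = 0%N.
  by move=> nj; rewrite mnmBE mnmE ltnNge nj.
have [->|u1] := eqVneq u 0%MM.
  rewrite Fh ?eqxx ?mulr1 => [|l]; last by rewrite mnm0E.
  by rewrite big1 ?add0r // => j nj; rewrite mpolyXM_mcoeff0 ?mulr0 // addm0 top0.
have [j0 /eqP uj0] : exists j, u == U_(j)%MM.
  by apply/mdeg1P; rewrite eqn_leq du lt0n mdeg_eq0.
have nj0 : (n <= j0)%N.
  rewrite leqNgt; apply/negP => /(widenP hnm)[l jl].
  by have := u0 l; rewrite uj0 jl mnm1E eqxx.
rewrite Fh // (negPf u1) mulr0 addr0 (bigD1 j0) //= big1 => [|j /andP[nj jj0]].
  rewrite uj0 mpolyXM_mcoeff -[(_ - _)%MM]addm0 Fh ?eqxx ?mulr1 ?addr0 //.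
  by move=> l; rewrite mnm0E.
by rewrite mpolyXM_mcoeff0 ?mulr0 // mnmDE top0 // uj0 mnm1E eq_sym (negPf jj0).
Qed.

Lemma pencil_adjugate : N *m (\matrix_(i, k) G i k) = F%:M.
Proof.
set Gm := \matrix_(i, k) G i k.
have GmE i k : Gm i k = G i k by rewrite mxE.
apply/eqP; rewrite -subr_eq0; apply/eqP/matrixP => i k; rewrite [RHS]mxE.
set M := N *m Gm - F%:M.
have ME h : M i h = S i h + \sum_l affine_part A A0 i l * G l h.
  rewrite !mxE /S; under eq_bigr => l _ do rewrite GmE pencilE mulrDl.
  rewrite big_split /= addrAC; congr (_ - _ + _).
  rewrite (bigD1 i) //= eqxx mulr1n big1 ?addr0 // => l li.
  by rewrite eq_sym (negPf li) mulr0n mul0r.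
have n0 : (0 < n)%N := leq_ltn_trans (leq0n _) (ltn_ord i).
apply: (@pencil_rigid _ _ _ hnm F sF DDF F1 (fun k => M i k) G) => //.
- move=> j h; rewrite /M; have := pencil_defect (@xderivM C m n hnm)
    (@xderiv_pencil C m n hnm A A0) (G := Gm) (F := F) _ i j h.
  by rewrite GmE; apply=> a b c; rewrite !GmE GG.
- move=> h; rewrite ME (leq_trans (mmeasureD_le _ _ _)) // geq_max; apply/andP; split.
    rewrite (leq_trans (mmeasureD_le _ _ _)) // geq_max mmeasureN; apply/andP; split.
      have := @msizeM_leq _ _ 'X_(w i) (G i h) 1 n.-1.
      by rewrite add1n prednK // msizeX mdeg1 msize_adjugate; apply.
    by case: eqP; rewrite ?mulr1n // mulr0n msize0.
  apply: msize_sum_leq => l _.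
  have := @msizeM_leq _ _ (affine_part A A0 i l) (G l h) 1 n.-1.
  by rewrite add1n prednK // msize_affine_part msize_adjugate; apply.
- exact: msize_adjugate.
- by move=> a b; have [] := GP a b.
- by move=> a b; have [] := GP a b.
- by move=> a b l; have [_ _ _ H] := GP a b; exact: H.
move=> h u u0 du /=; rewrite ME mcoeffD raddf_sum /= (bigD1 h) //=.
(* For l other than h, x_l occurs neither in the affine part nor in G_lh, but it divides the
   monomial. Only l = h contributes, and the choice of [Acoef] cancels it against [S]. *)
rewrite big1 => [|l lh]; last first.
  apply: (@mderiv_eq0_mcoeff _ _ (w l)).
    have [_ + _ _] := GP l h; rewrite !xderivE mderivM => ->.
    by rewrite -xderivE xderiv_affine_part mul0r mulr0 addr0.
  rewrite !(mnmDE, mnmBE) mtopE mnm1E (inj_eq (@widen_ord_inj _ _ hnm)).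
  by rewrite [h == l]eq_sym (negPf lh).
by rewrite addr0 Gii mcoeff_affine_mul // [Acoef u i h]mxE subrr.
Qed.

Lemma det_pencil_exists : F = \det N.
Proof.
have NG := congr1 (mulmx (\adj N)) pencil_adjugate.
rewrite mulmxA mul_adj_mx mul_scalar_mx mul_mx_scalar in NG.
apply/esym/eqP; rewrite -subr_eq0; apply/eqP.
apply: (@proportional_rigid _ _ _ hnm F sF DDF F1) => [l||].
(* Since det N G = F adj N, the diagonal entries give det N D_l F = F D_l (det N), so det N - F
   satisfies the proportionality equation. *)
- have := congr1 (fun X : 'M_n => X l l) NG.
  rewrite [LHS]mxE [X in _ * X]mxE Gii [RHS]mxE.
  rewrite -(deriv_det (@xderivM C m n hnm) (@xderiv_pencil C m n hnm A A0)) -/N => E.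
  by rewrite -!xderivE raddfB /= mulrBr -E mulrBr [_ * F]mulrC [_ * \det N]mulrC.
- by rewrite (leq_trans (mmeasureD_le _ _ _)) // geq_max mmeasureN sF msize_det_pencil.
- by rewrite mcoeffB F1 mcoeff_det_pencil subrr.
Qed.

Lemma hermitian_pencil_exists : exists (B : 'I_m -> 'M[C]_n) (B0 : 'M[C]_n),
  [/\ forall j : 'I_m, (n <= j)%N -> B j \is hermsymmx, B0 \is hermsymmx
    & F = \det (pencil hnm B B0)].
Proof.
exists A, A0; split; last exact: det_pencil_exists.
- move=> j nj; apply: Acoef_herm => l; rewrite mnm1E; case: eqP nj => // ->.
  by rewrite /= leqNgt ltn_ord.
- by apply: Acoef_herm => l; rewrite mnm0E.
Qed.

End Representation.

(** * Passage from real to complex coefficients *)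

Section Complexification.
Variables (R : rcfType) (m n : nat) (hnm : (n <= m)%N) (f : {mpoly R[m]}).
Local Notation w := (widen_ord hnm).
Local Notation F := (mpoly_complex f).

Lemma mcoeff_complex u : F@_u = (f@_u)%:C%C.
Proof. exact: mcoeff_map_mpoly. Qed.

Lemma xconj_complex : xconj R[i] m F = F.
Proof.
apply/mpolyP => u; apply: etrans (mcoeff_xconj F u) _; rewrite mcoeff_complex.
exact: conjc_real.
Qed.

Lemma msize_complex : (msize F <= msize f)%N.
Proof.
apply/msize_leP => u; rewrite mcoeff_complex => fu.
apply: (msize_leP f (msize f)).2 => //.
by apply: contraNneq fu => ->.
Qed.

Lemma rayleigh_diff_complex i j :
  mpoly_complex (rayleigh_diff (w i) (w j) f) = rayleigh (@xderiv R[i] m n hnm) F i j.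
Proof.
rewrite /mpoly_complex /rayleigh_diff rmorphB !rmorphM /= !map_mpoly_mderiv.
by rewrite (mderiv_comm (w i)).
Qed.

Lemma multiaffine_xderiv2 l : multiaffine_in [set i : 'I_m | (i < n)%N] f ->
  xderiv R[i] hnm l (xderiv R[i] hnm l F) = 0.
Proof.
move=> /(_ (w l)); rewrite inE /= ltn_ord => /(_ isT) H.
apply/mpolyP => u; rewrite mcoeff0 !mcoeff_mderiv mcoeff_complex.
suff -> : f@_(u + U_(w l) + U_(w l)) = 0 by rewrite rmorph0 !mul0rn.
apply/eqP; rewrite mcoeff_eq0; apply/negP => fu.
move: H; rewrite leqNgt => /negP; apply.
apply: leq_trans (leq_bigmax_seq _ fu isT).
by rewrite !mnmDE mnm1E eqxx addn1 addn1.
Qed.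

End Complexification.

(* The variables x_1, ..., x_m are 'X_j for j : 'I_m (so x_1, ..., x_n are
   those with j < n), and msize is one plus the total degree. Only the values
   A j with n <= j are used. *)
Theorem corollary5p4 (R : realType) (m n : nat) (hnm : (n <= m)%N)
    (f : {mpoly R[m]})
    (hdeg : msize f = n.+1)
    (haff : multiaffine_in [set i : 'I_m | (i < n)%N] f)
    (hcoef : f@_[multinom ((i < n)%N : nat) | i < m] = 1) :
  (exists (A : 'I_m -> 'M[R[i]]_n) (A0 : 'M[R[i]]_n),
     [/\ forall j : 'I_m, (n <= j)%N -> A j \is hermsymmx,
         A0 \is hermsymmx &
         mpoly_complex f =
           \det (diag_mx (\row_(i < n) 'X_(widen_ord hnm i))
                 + \sum_(j < m | (n <= j)%N) 'X_j *: mpolyC_mx m (A j)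
                 + mpolyC_mx m A0)])
  <->
  (forall i j : 'I_n,
     exists g : {mpoly R[i][m]},
       mpoly_complex (rayleigh_diff (widen_ord hnm i) (widen_ord hnm j) f)
       = g * mpoly_conj g).
Proof.
split=> [[A [A0 [hA hA0 fE]]] i j|fact].
  exists ((\adj (pencil hnm A A0)) i j).
  by rewrite rayleigh_diff_complex fE; exact: (rayleigh_det_pencil hnm).
have DDF l := multiaffine_xderiv2 hnm l haff.
have sF : (msize (mpoly_complex f) <= n.+1)%N by rewrite -hdeg msize_complex.
have F1 : (mpoly_complex f)@_(mtop m n) = 1.
  by rewrite mcoeff_complex hcoef rmorph1.
have rayleighP i j : exists g,
    rayleigh (@xderiv R[i] m n hnm) (mpoly_complex f) i j = g * xconj R[i] m g.
  by have [g] := fact i j; rewrite rayleigh_diff_complex; exists g.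
have [G [Gii cjG GG]] := adjugate_system_exists (@xconjK R[i] m) (factorial_mpoly _ m)
  (@mpoly_char0 R[i] m) (@xderivM R[i] m n hnm) (@xderivC R[i] m n hnm)
  (@xderiv_conj R[i] m n hnm)
  (@xderiv_nilpotent R[i] m n hnm) (xconj_complex f) DDF rayleighP.
exact: (hermitian_pencil_exists (xconj_complex f) DDF sF F1 Gii cjG GG).
Qed.
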